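(* Let $n,m\ge2$ and let $l>0$ be the minimal positive integer such that $m$ divides $ln$. Identify the complex braid group $B(m,m,n)$ with the subgroup $\tilde A(\Delta_n^m)=\langle h_1,\dots,h_{n-1},uh_1u^{-1}\rangle$ of $Z_n(D_{\mathbb{Z}_m})$. Then the center of $B(m,m,n)$ contains the non-trivial element $\theta_n^{\,l}$, where $\theta_n:=\gamma_n\gamma_{n-1}\cdots\gamma_1$ and $\gamma_j:=h_{j-1}\cdots h_1\,u\,h_1\cdots h_{j-1}$ for $1\le j\le n$.
   Context: $D_{\mathbb{Z}_m}$ is the orbifold given by $\mathbb{Z}_m$ acting on a disk $D$ by rotations about its center. Its orbifold braid group $Z_n(D_{\mathbb{Z}_m})$ is the orbifold fundamental group of the quotient orbifold of $\{(x_1,\dots,x_n)\in D^n\mid x_i\ne g(x_j)\ \forall g\in\mathbb{Z}_m,\ i\neq j\}$ by $\mathbb{Z}_m^n\rtimes S_n$. By a known earlier theorem, which also fixes the generators, it has the presentation with generators $h_1,\dots,h_{n-1},u$ and defining relations $u^m=1$; $h_{j-1}h_jh_{j-1}=h_jh_{j-1}h_j$ for $2\le j<n$; $[h_k,h_l]=1$ for $|k-l|\ge2$; $[u,h_j]=1$ for $2\le j<n$; and $[h_1uh_1,u]=1$. $B(m,m,n)$ is the complex braid group $\pi_1((\mathbb{C}^n\setminus\bigcup_rH_r)/W)$ of the finite group $W=G(m,m,n)$ of monomial $n\times n$ complex matrices whose non-zero entries are $m$-th roots of unity with product $1$, where $r$ runs over the elements of $W$ with $H_r=\ker(r-\mathrm{id})$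 of codimension one. The group $\tilde A(\Delta_n^m)$ has generators $h_1^u,h_1,\dots,h_{n-1}$ and relations: $xyx=yxy$ for generators whose subscripts differ by $1$; $[x,y]=1$ for generators whose subscripts differ by at least $2$; $\langle h_1,h_1^u\rangle_m=\langle h_1^u,h_1\rangle_m$, with $\langle a,b\rangle_k$ the alternating word $aba\cdots$ of $k$ letters; and, if $n\ge3$, $(h_1h_1^uh_2)^2=(h_2h_1h_1^u)^2$. It is known (Broué–Malle–Rouquier) that $B(m,m,n)\cong\tilde A(\Delta_n^m)$, and $\tilde A(\Delta_n^m)$ is identified with the subgroup of $Z_n(D_{\mathbb{Z}_m})$ generated by $h_1,\dots,h_{n-1}$ and $h_1^u:=uh_1u^{-1}$; this is the identification referred to in the claim. *)

(* Defs.v *)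
From HB Require Import structures.
From mathcomp Require Import all_boot all_order all_algebra all_fingroup.
From mathcomp Require Import generic_quotient.
From mathcomp Require Import all_classical all_reals all_analysis.
From mathcomp Require Import complex.
From mathcomp Require Import ring lra.
Set Implicit Arguments.
Unset Strict Implicit.
Unset Printing Implicit Defensive.
Import numFieldNormedType.Exports.
Import Order.TTheory GRing.Theory Num.Theory.

Local Open Scope quotient_scope.
Local Open Scope classical_set_scope.
Local Open Scope ring_scope.

Section Paths.
Context {R : realType} {T : topologicalType}.
Implicit Types (f g h : R -> T) (x y z : T).

Definition is_path f x y :=
  [/\ {within `[0, 1], continuous f}, f 0 = x & f 1 = y].

(* Homotopy relative to the endpoints; the first variable of H is the homotopy
   parameter. Values outside [0, 1] are irrelevant. *)
Definition homotopic f g := exists H : R * R -> T,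
  [/\ {within `[0, 1] `*` `[0, 1], continuous H},
      forall t, t \in `[0, 1] -> H (0, t) = f t,
      forall t, t \in `[0, 1] -> H (1, t) = g t,
      forall s, s \in `[0, 1] -> H (s, 0) = f 0 &
      forall s, s \in `[0, 1] -> H (s, 1) = f 1].

Definition path_cat f g t := if t <= 2^-1 then f (2 * t) else g (2 * t - 1).

Definition path_rev f t := f (1 - t).

End Paths.

Section PathsTheory.
Context {R : realType}.
Local Notation I := (`[0 : R, 1 : R]%classic).
Local Notation II := (I `*` I).

Lemma within_comp {X Y Z : topologicalType} (A : set X) (B : set Y)
    (p : X -> Y) (f : Y -> Z) :
  continuous p -> (forall x, A x -> B (p x)) ->
  {within B, continuous f} -> {within A, continuous (f \o p)}.
Proof.
move=> cp AB /subspace_continuousP cf; apply/subspace_continuousP => x Ax.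
apply: cvg_comp (cf _ (AB _ Ax)) => U.
rewrite /within/= => /cp; rewrite !nbhs_simpl/= /nbhs/= => nU.
by apply: filterS nU => y /= yU /AB; exact: yU.
Qed.

Lemma within_eq {X Z : topologicalType} (A : set X) (f g : X -> Z) :
  (forall x, A x -> f x = g x) -> {within A, continuous f} ->
  {within A, continuous g}.
Proof.
by move=> fg; apply: subspace_eq_continuous => x /set_mem; exact: fg.
Qed.

Lemma within_paste {X Z : topologicalType} (A : set X) (u : X -> R)
    (F G : X -> Z) : closed A -> continuous u ->
  {within A `&` [set x | u x <= 2^-1], continuous F} ->
  {within A `&` [set x | 2^-1 <= u x], continuous G} ->
  (forall x, A x -> u x = 2^-1 -> F x = G x) ->
  {within A, continuous (fun x => if u x <= 2^-1 then F x else G x)}.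
Proof.
move=> cA cu cF cG FG.
have -> : A = (A `&` [set x | u x <= 2^-1]) `|` (A `&` [set x | 2^-1 <= u x]).
  rewrite -setIUr; apply/seteqP; split=> x; last by case.
  by move=> Ax; split=> //=; case: (leP (u x) 2^-1) => [|/ltW]; [left|right].
apply: withinU_continuous.
- apply: closedI => //.
  exact: ((continuous_closedP u).1 cu [set y | y <= 2^-1] (@closed_le _ _)).
- apply: closedI => //.
  exact: ((continuous_closedP u).1 cu [set y | 2^-1 <= y] (@closed_ge _ _)).
- by apply: within_eq cF => x [_ /= ->].
- apply: within_eq cG => x [Ax /= xh]; case: ifPn => // xh'.
  by rewrite FG//; apply/eqP; rewrite eq_le xh xh'.
Qed.

Lemma closedI01 : closed I. Proof. exact: interval_closed. Qed.

Lemma closedII : closed II.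
Proof.
rewrite (_ : II = fst @^-1` I `&` snd @^-1` I); last by apply/seteqP; split=> x [].
apply: closedI; apply: (continuous_closedP _).1; try exact: closedI01.
  by move=> x; exact: cvg_fst.
by move=> x; exact: cvg_snd.
Qed.

Lemma I0 : (0 : R) \in `[0, 1]. Proof. by rewrite in_itv/= lexx ler01. Qed.
Lemma I1 : (1 : R) \in `[0, 1]. Proof. by rewrite in_itv/= lexx ler01. Qed.

Lemma cts_mull (X : topologicalType) (c : R) (u : X -> R) :
  continuous u -> continuous (fun x => c * u x).
Proof. by move=> cu x; apply: cvgM; [exact: cvg_cst|exact: cu]. Qed.

Lemma cts_add (X : topologicalType) (u v : X -> R) :
  continuous u -> continuous v -> continuous (fun x => u x + v x).
Proof. by move=> cu cv x; apply: cvgD; [exact: cu|exact: cv]. Qed.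

Lemma cts_mul (X : topologicalType) (u v : X -> R) :
  continuous u -> continuous v -> continuous (fun x => u x * v x).
Proof. by move=> cu cv x; apply: cvgM; [exact: cu|exact: cv]. Qed.

Lemma cts_cst (X Y : topologicalType) (c : Y) : continuous (fun _ : X => c).
Proof. by move=> x; exact: cvg_cst. Qed.

Lemma cts_id (X : topologicalType) : continuous (fun x : X => x).
Proof. by move=> x; exact: cvg_id. Qed.

Lemma cts_opp (X : topologicalType) (u : X -> R) :
  continuous u -> continuous (fun x => - u x).
Proof. by move=> cu x; apply: cvgN; exact: cu. Qed.

Lemma cts_fst (X Y : topologicalType) : continuous (fun x : X * Y => x.1).
Proof. by move=> x; exact: cvg_fst. Qed.

Lemma cts_snd (X Y : topologicalType) : continuous (fun x : X * Y => x.2).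
Proof. by move=> x; exact: cvg_snd. Qed.

Lemma cts_pair (X Y Z : topologicalType) (u : X -> Y) (v : X -> Z) :
  continuous u -> continuous v -> continuous (fun x => (u x, v x)).
Proof. by move=> cu cv x; apply: cvg_pair; [exact: cu|exact: cv]. Qed.

Lemma cts_min (X : topologicalType) (u v : X -> R) :
  continuous u -> continuous v -> continuous (fun x => Num.min (u x) (v x)).
Proof. by move=> cu cv x; apply: continuous_min; [exact: cu|exact: cv]. Qed.

Lemma cts_max (X : topologicalType) (u v : X -> R) :
  continuous u -> continuous v -> continuous (fun x => Num.max (u x) (v x)).
Proof. by move=> cu cv x; apply: continuous_max; [exact: cu|exact: cv]. Qed.

End PathsTheory.

Ltac cts := repeat first
  [ exact: cts_id | exact: cts_cst | exact: cts_fst | exact: cts_snd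
  | apply: cts_add | apply: cts_opp | apply: cts_mul | apply: cts_min
  | apply: cts_max | apply: cts_pair ].

Lemma minD (R : realType) (a b : R) :
  (Num.min a b = a /\ a <= b) \/ (Num.min a b = b /\ b <= a).
Proof. by case: (leP a b) => [|/ltW] ?; [left|right]. Qed.

Lemma maxD (R : realType) (a b : R) :
  (Num.max a b = a /\ b <= a) \/ (Num.max a b = b /\ a <= b).
Proof. by case: (leP a b) => [|/ltW] ?; [right|left]. Qed.

Ltac minmax := repeat match goal with
  | |- context [Order.min ?a ?b] =>
    lazymatch b with context [Order.min _ _] => fail | _ => idtac end;
    let E := fresh in destruct (minD a b) as [[E ?]|[E ?]]; rewrite !{}E
  | |- context [Order.max ?a ?b] =>
    let E := fresh in destruct (maxD a b) as [[E ?]|[E ?]]; rewrite !{}E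
  end.

Section PathsTheory2.
Context {R : realType} {T : topologicalType}.
Local Notation I := (`[0 : R, 1 : R]%classic).
Local Notation II := (I `*` I).
Implicit Types (f g h : R -> T) (x y z : T).

Lemma is_path_cst x : @is_path R T (fun=> x) x x.
Proof. by split=> //; apply: continuous_subspaceT => ?; exact: cvg_cst. Qed.

Lemma is_path_cat f g x y z :
  is_path f x y -> is_path g y z -> is_path (path_cat f g) x z.
Proof.
move=> [cf f0 f1] [cg g0 g1]; split.
- apply: (@within_paste _ _ _ I id (fun t => f (2 * t)) (fun t => g (2 * t - 1))).
  + exact: closedI01.
  + by move=> ?; exact: cvg_id.
  + apply: within_comp cf; first by cts.
    by move=> t [] /=; rewrite !in_itv/= => /andP[? ?] ?; apply/andP; split; lra.
  + apply: (@within_comp _ _ _ _ I (fun t : R => 2 * t - 1)) cg; first by cts.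
    by move=> t [] /=; rewrite !in_itv/= => /andP[? ?] ?; apply/andP; split; lra.
  + move=> t _ ->; rewrite divff// subrr g0 f1 //.
- by rewrite /path_cat ifT ?mulr0// invr_ge0.
- rewrite /path_cat ifF; first by rewrite mulr1 (_ : 2 - 1 = 1)//; lra.
  by apply/negbTE; rewrite -ltNge; lra.
Qed.

Lemma is_path_rev f x y : is_path f x y -> is_path (path_rev f) y x.
Proof.
move=> [cf f0 f1]; split; rewrite /path_rev ?subr0 ?subrr//.
apply: (within_comp _ _ cf); first by cts.
by move=> t /=; rewrite !in_itv/= => /andP[? ?]; apply/andP; split; lra.
Qed.

Lemma homotopic_eq f g : {within I, continuous f} ->
  (forall t, t \in `[0, 1] -> f t = g t) -> homotopic f g.
Proof.
move=> cf fg; exists (fun p => f p.2); split => //.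
by apply: (within_comp _ _ cf); [cts|move=> [? ?] []].
Qed.

Lemma homotopic_refl f : {within I, continuous f} -> homotopic f f.
Proof. by move=> cf; exact: homotopic_eq. Qed.

Lemma homotopic_ends f g : homotopic f g -> f 0 = g 0 /\ f 1 = g 1.
Proof.
move=> [H [_ H0 H1 Hl Hr]]; split.
  by rewrite -(Hl 1) ?I1// H1 ?I0.
by rewrite -(Hr 1) ?I1// H1 ?I1.
Qed.

Lemma homotopic_sym f g : homotopic f g -> homotopic g f.
Proof.
move=> fg; have [e0 e1] := homotopic_ends fg.
case: fg => H [cH H0 H1 Hl Hr]; exists (fun p => H (1 - p.1, p.2)); split.
- apply: (within_comp _ _ cH); first by cts.
  move=> [s t] [/=]; rewrite !in_itv/= => /andP[? ?] /andP[? ?].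
  by split; rewrite /= ?in_itv/=; apply/andP; split; lra.
- by move=> t tI; rewrite /= subr0 H1.
- by move=> t tI; rewrite /= subrr H0.
- move=> s; rewrite in_itv/= => /andP[? ?].
  by rewrite /= Hl// in_itv/=; apply/andP; split; lra.
- move=> s; rewrite in_itv/= => /andP[? ?].
  by rewrite /= Hr// in_itv/=; apply/andP; split; lra.
Qed.

Lemma homotopic_trans g f h : homotopic f g -> homotopic g h -> homotopic f h.
Proof.
move=> fg; have [e0 e1] := homotopic_ends fg.
case: fg => H [cH H0 H1 Hl Hr] [K [cK K0 K1 Kl Kr]].
exists (fun p => if p.1 <= 2^-1 then H (2 * p.1, p.2) else K (2 * p.1 - 1, p.2)).
split.
- apply: (@within_paste _ _ _ II fst (fun p => H (2 * p.1, p.2))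
    (fun p => K (2 * p.1 - 1, p.2))).
  + exact: closedII.
  + by cts.
  + apply: (@within_comp _ _ _ _ II (fun p : R * R => (2 * p.1, p.2))) cH.
      by cts.
    move=> [s t] [] [] /=; rewrite !in_itv/= => /andP[? ?] /andP[? ?] ?.
    by split; rewrite /= ?in_itv/=; apply/andP; split; lra.
  + apply: (@within_comp _ _ _ _ II (fun p : R * R => (2 * p.1 - 1, p.2))) cK.
      by cts.
    move=> [s t] [] [] /=; rewrite !in_itv/= => /andP[? ?] /andP[? ?] ?.
    by split; rewrite /= ?in_itv/=; apply/andP; split; lra.
  + by move=> [s t] [_ tI] /= ->; rewrite divff// subrr H1 ?K0.
- by move=> t tI /=; rewrite ifT ?mulr0 ?H0// invr_ge0.
- move=> t tI /=; rewrite ifF; last by apply/negbTE; rewrite -ltNge; lra.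
  by rewrite mulr1 (_ : 2 - 1 = 1) ?K1//; lra.
- move=> s; rewrite in_itv/= => /andP[? ?]; case: ifPn => [?|]; last first.
    by rewrite -ltNge => ?; rewrite Kl// in_itv/=; apply/andP; split; lra.
  by rewrite Hl// in_itv/=; apply/andP; split; lra.
- move=> s; rewrite in_itv/= => /andP[? ?]; case: ifPn => [?|]; last first.
    by rewrite -ltNge => ?; rewrite Kr// in_itv/=; apply/andP; split; lra.
  by rewrite Hr// in_itv/=; apply/andP; split; lra.
Qed.

Lemma homotopic_cat f f' g g' : f 1 = g 0 ->
  homotopic f f' -> homotopic g g' -> homotopic (path_cat f g) (path_cat f' g').
Proof.
move=> fg [H [cH H0 H1 Hl Hr]] [K [cK K0 K1 Kl Kr]].
exists (fun p => if p.2 <= 2^-1 then H (p.1, 2 * p.2) else K (p.1, 2 * p.2 - 1)).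
have aux1 (t : R) : t \in `[0, 1] -> t <= 2^-1 -> 2 * t \in `[0, 1].
  by rewrite !in_itv/= => /andP[? ?] ?; apply/andP; split; lra.
have aux2 (t : R) : t \in `[0, 1] -> 2^-1 <= t -> 2 * t - 1 \in `[0, 1].
  by rewrite !in_itv/= => /andP[? ?] ?; apply/andP; split; lra.
have aux3 (t : R) : t \in `[0, 1] -> ~~ (t <= 2^-1) -> 2 * t - 1 \in `[0, 1].
  by rewrite -ltNge => tI /ltW; exact: aux2.
split.
- apply: (@within_paste _ _ _ II snd (fun p => H (p.1, 2 * p.2))
    (fun p => K (p.1, 2 * p.2 - 1))).
  + exact: closedII.
  + by cts.
  + apply: (@within_comp _ _ _ _ II (fun p : R * R => (p.1, 2 * p.2))) cH.
      by cts.
    by move=> [s t] [] [] /= sI tI t2; split => //=; exact: aux1.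
  + apply: (@within_comp _ _ _ _ II (fun p : R * R => (p.1, 2 * p.2 - 1))) cK.
      by cts.
    by move=> [s t] [] [] /= sI tI t2; split => //=; exact: aux2.
  + by move=> [s t] [sI _] /= ->; rewrite divff// subrr Hr ?Kl.
- by move=> t tI /=; rewrite /path_cat; case: ifPn => ?; rewrite ?H0 ?K0 ?aux1 ?aux3.
- by move=> t tI /=; rewrite /path_cat; case: ifPn => ?; rewrite ?H1 ?K1 ?aux1 ?aux3.
- by move=> s sI; rewrite /path_cat/= invr_ge0 ler0n mulr0 Hl.
- move=> s sI; rewrite /path_cat/= ifF; last by apply/negbTE; rewrite -ltNge; lra.
  rewrite ifF; last by apply/negbTE; rewrite -ltNge; lra.
  by rewrite mulr1 (_ : 2 - 1 = 1) ?Kr//; lra.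
Qed.

Lemma homotopic_reparam f (p q : R -> R) : {within I, continuous f} ->
  continuous p -> continuous q -> {homo p : t / t \in `[0, 1]} ->
  {homo q : t / t \in `[0, 1]} -> p 0 = q 0 -> p 1 = q 1 ->
  homotopic (f \o p) (f \o q).
Proof.
move=> cf cp cq pI qI pq0 pq1.
exists (fun r => f ((1 - r.1) * p r.2 + r.1 * q r.2)); split.
- apply: (@within_comp _ _ _ _ _
    (fun r : R * R => (1 - r.1) * p r.2 + r.1 * q r.2)) cf.
    have c2 (v : R -> R) : continuous v -> continuous (fun r : R * R => v r.2).
      by move=> cr r; apply: continuous_comp; [exact: cts_snd|exact: cr].
    apply: cts_add; apply: cts_mul; first (by cts); last exact: c2.
      exact: c2.
    by cts.
  move=> [s t] [/= + tI]; move: (pI _ tI) (qI _ tI).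
  by rewrite !in_itv/= => /andP[? ?] /andP[? ?] /andP[? ?]; apply/andP; split; nra.
- by move=> t _ /=; rewrite subr0 mul1r mul0r addr0.
- by move=> t _ /=; rewrite subrr mul1r mul0r add0r.
- by move=> s _ /=; rewrite -pq0 -mulrDl subrK mul1r.
- by move=> s _ /=; rewrite -pq1 -mulrDl subrK mul1r.
Qed.

Lemma homotopic_repar f g (p : R -> R) : {within I, continuous g} ->
  continuous p -> {homo p : t / t \in `[0, 1]} -> p 0 = 0 -> p 1 = 1 ->
  {within I, continuous f} ->
  (forall t, t \in `[0, 1] -> f t = g (p t)) -> homotopic f g.
Proof.
move=> cg cp pI p0 p1 cf fgp.
apply: (@homotopic_trans (g \o p)); first exact: homotopic_eq.
rewrite -[X in homotopic _ X](_ : g \o id = g)//.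
by apply: homotopic_reparam => //; cts.
Qed.

Lemma homotopic_catA f g h x y z w :
  is_path f x y -> is_path g y z -> is_path h z w ->
  homotopic (path_cat (path_cat f g) h) (path_cat f (path_cat g h)).
Proof.
move=> pf pg ph.
have [c1 _ _] := is_path_cat (is_path_cat pf pg) ph.
have [c2 _ _] := is_path_cat pf (is_path_cat pg ph).
apply: (@homotopic_repar _ _
  (fun t => Num.min (2 * t) (Num.min (t + 4^-1) (2^-1 * t + 2^-1)))) => //.
- by cts.
- by move=> t; rewrite !in_itv/= => /andP[? ?]; minmax; apply/andP; split; lra.
- by minmax; lra.
- by minmax; lra.
- have [_ f0 f1] := pf; have [_ g0 g1] := pg; have [_ h0 h1] := ph.
  move=> t; rewrite in_itv/= => /andP[? ?]; rewrite /path_cat.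
  case: (leP t 2^-1) => ?.
    case: (leP (2 * t) 2^-1) => ?.
      rewrite (_ : Num.min _ _ = 2 * t); last first.
        by minmax; lra.
      by rewrite ifT.
    rewrite (_ : Num.min _ _ = t + 4^-1); last first.
      by minmax; lra.
    rewrite ifF; last by apply/negbTE; rewrite -ltNge; lra.
    rewrite ifT; last by lra.
    by congr g; lra.
  rewrite (_ : Num.min _ _ = 2^-1 * t + 2^-1); last first.
    by minmax; lra.
  rewrite ifF; last by apply/negbTE; rewrite -ltNge; lra.
  rewrite ifF; last by apply/negbTE; rewrite -ltNge; lra.
  by congr h; lra.
Qed.

Lemma homotopic_cat1 f x y : is_path f x y ->
  homotopic (path_cat f (fun=> y)) f.
Proof.
move=> pf; have [cf f0 f1] := pf.
have [c1 _ _] := is_path_cat pf (is_path_cst y).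
apply: (@homotopic_repar _ _ (fun t => Num.min 1 (2 * t))) => //.
- by cts.
- by move=> t; rewrite !in_itv/= => /andP[? ?]; minmax; apply/andP; split; lra.
- by minmax; lra.
- by minmax; lra.
- move=> t; rewrite in_itv/= => /andP[? ?]; rewrite /path_cat.
  by minmax; case: (leP t 2^-1) => ?; rewrite -?f1; congr f; lra.
Qed.

Lemma homotopic_1cat f x y : is_path f x y ->
  homotopic (path_cat (fun=> x) f) f.
Proof.
move=> pf; have [cf f0 f1] := pf.
have [c1 _ _] := is_path_cat (is_path_cst x) pf.
apply: (@homotopic_repar _ _ (fun t => Num.max 0 (2 * t - 1))) => //.
- by cts.
- by move=> t; rewrite !in_itv/= => /andP[? ?]; minmax; apply/andP; split; lra.
- by minmax; lra.
- by minmax; lra.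
- move=> t; rewrite in_itv/= => /andP[? ?]; rewrite /path_cat.
  by minmax; case: (leP t 2^-1) => ?; rewrite -?f0; congr f; lra.
Qed.

Lemma homotopic_catN f x y : is_path f x y ->
  homotopic (path_cat f (path_rev f)) (fun=> x).
Proof.
move=> pf; have [cf f0 f1] := pf.
have [c1 _ _] := is_path_cat pf (is_path_rev pf).
apply: (@homotopic_trans (f \o (fun t => Num.min (2 * t) (2 - 2 * t)))).
  apply: homotopic_eq => // t; rewrite in_itv/= => /andP[? ?].
  rewrite /path_cat /path_rev /=.
  by minmax; case: (leP t 2^-1) => ?; congr f; lra.
rewrite -[X in homotopic _ X](_ : f \o (fun=> 0) = _); last first.
  by apply/funext => t /=.
apply: homotopic_reparam => //.
- by cts.
- by cts.
- by move=> t; rewrite !in_itv/= => /andP[? ?]; minmax; apply/andP; split; lra.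
- by move=> t _; exact: I0.
- by minmax; lra.
- by minmax; lra.
Qed.

Lemma path_revK f : path_rev (path_rev f) = f.
Proof. by apply/funext => t; rewrite /path_rev subKr. Qed.

Lemma homotopic_Ncat f x y : is_path f x y ->
  homotopic (path_cat (path_rev f) f) (fun=> y).
Proof. by move=> /is_path_rev/homotopic_catN; rewrite path_revK. Qed.

Lemma homotopic_rev f g : homotopic f g -> homotopic (path_rev f) (path_rev g).
Proof.
move=> fg; have [e0 e1] := homotopic_ends fg.
case: fg => H [cH H0 H1 Hl Hr].
have aux (t : R) : t \in `[0, 1] -> 1 - t \in `[0, 1].
  by rewrite !in_itv/= => /andP[? ?]; apply/andP; split; lra.
exists (fun p => H (p.1, 1 - p.2)); split.
- apply: (within_comp _ _ cH); first by cts.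
  by move=> [s t] [/= sI tI]; split => //=; exact: aux.
- by move=> t tI; rewrite /= H0// aux.
- by move=> t tI; rewrite /= H1// aux.
- by move=> s sI; rewrite /path_rev /= subr0 Hr.
- by move=> s sI; rewrite /path_rev /= subrr Hl.
Qed.

End PathsTheory2.

Section PathsMap.
Context {R : realType} {T U : topologicalType} (a : T -> U) (ca : continuous a).
Implicit Types (f g : R -> T).

Lemma is_path_map f x y : is_path f x y -> is_path (a \o f) (a x) (a y).
Proof.
move=> [cf f0 f1]; split; rewrite /= ?f0 ?f1//.
by move=> t; apply: (@continuous_comp (subspace _) T U f a); [exact: cf|exact: ca].
Qed.

Lemma homotopic_map f g : homotopic f g -> homotopic (a \o f) (a \o g).
Proof.
move=> [H [cH H0 H1 Hl Hr]]; exists (a \o H); split.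
- by move=> t; apply: (@continuous_comp (subspace _) T U H a); [exact: cH|exact: ca].
- by move=> t tI; rewrite /= H0.
- by move=> t tI; rewrite /= H1.
- by move=> t tI; rewrite /= Hl.
- by move=> t tI; rewrite /= Hr.
Qed.

Lemma path_cat_map f g : a \o path_cat f g = path_cat (a \o f) (a \o g).
Proof. by apply/funext => t; rewrite /path_cat /=; case: ifP. Qed.

End PathsMap.

Section FundamentalGroup.
Context {R : realType} {T : topologicalType} (x0 : T).

Record loop := Loop {
  loop_fun :> R -> T;
  loopP : is_path loop_fun x0 x0 }.

HB.instance Definition _ := gen_eqMixin loop.
HB.instance Definition _ := gen_choiceMixin loop.

Lemma loop_cts (f : loop) : {within `[0, 1], continuous f}.
Proof. by have [] := loopP f. Qed.

Definition loop_rel : rel loop := fun f g => `[< homotopic f g >].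

Lemma loop_rel_equiv : equiv_class_of loop_rel.
Proof.
split=> [f|f g|g f h]; first by apply/asboolP/homotopic_refl/loop_cts.
  by apply/asboolP/asboolP; exact: homotopic_sym.
by move=> /asboolP fg /asboolP gh; exact/asboolP/(homotopic_trans fg).
Qed.

Canonical loop_equiv := EquivRelPack loop_rel_equiv.

Definition pi1 := {eq_quot loop_equiv}.

HB.instance Definition _ := Choice.on pi1.
HB.instance Definition _ := EqQuotient.on pi1.

Definition loop1 := Loop (@is_path_cst R T x0).
Definition loopM (f g : loop) := Loop (is_path_cat (loopP f) (loopP g)).
Definition loopV (f : loop) := Loop (is_path_rev (loopP f)).

Definition pi1_one : pi1 := \pi_pi1 loop1.
Definition pi1_mul (a b : pi1) : pi1 := \pi_pi1 (loopM (repr a) (repr b)).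
Definition pi1_inv (a : pi1) : pi1 := \pi_pi1 (loopV (repr a)).

Lemma pi1_eqP (f g : loop) : (\pi_pi1 f = \pi_pi1 g) <-> homotopic f g.
Proof.
by split=> [/eqmodP/asboolP//|fg]; apply/eqmodP/asboolP.
Qed.

Lemma pi1_reprP (f : loop) : homotopic (repr (\pi_pi1 f)) f.
Proof. by apply/pi1_eqP; rewrite reprK. Qed.

Lemma loop01 (f g : loop) : f 1 = g 0.
Proof. by have [_ _ ->] := loopP f; have [_ -> _] := loopP g. Qed.

Lemma pi1_mulE (f g : loop) :
  pi1_mul (\pi_pi1 f) (\pi_pi1 g) = \pi_pi1 (loopM f g).
Proof.
by apply/pi1_eqP/homotopic_cat; [exact: loop01|exact: pi1_reprP..].
Qed.

Lemma pi1_invE (f : loop) : pi1_inv (\pi_pi1 f) = \pi_pi1 (loopV f).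
Proof. exact/pi1_eqP/homotopic_rev/pi1_reprP. Qed.

Lemma pi1_mulA : associative pi1_mul.
Proof.
elim/quotW=> f; elim/quotW=> g; elim/quotW=> h; rewrite (pi1_mulE g h) (pi1_mulE f g) !pi1_mulE.
apply/pi1_eqP/homotopic_sym.
exact: (homotopic_catA (loopP f) (loopP g) (loopP h)).
Qed.

Lemma pi1_mul1 : left_id pi1_one pi1_mul.
Proof.
elim/quotW=> f; rewrite /pi1_one pi1_mulE.
exact/pi1_eqP/(homotopic_1cat (loopP f)).
Qed.

Lemma pi1_mulr1 : right_id pi1_one pi1_mul.
Proof.
elim/quotW=> f; rewrite /pi1_one pi1_mulE.
exact/pi1_eqP/(homotopic_cat1 (loopP f)).
Qed.

Lemma pi1_mulV : left_inverse pi1_one pi1_inv pi1_mul.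
Proof.
elim/quotW=> f; rewrite /pi1_one pi1_invE pi1_mulE.
exact/pi1_eqP/(homotopic_Ncat (loopP f)).
Qed.

Lemma pi1_mulrV : right_inverse pi1_one pi1_inv pi1_mul.
Proof.
elim/quotW=> f; rewrite /pi1_one pi1_invE pi1_mulE.
exact/pi1_eqP/(homotopic_catN (loopP f)).
Qed.

HB.instance Definition _ := isGroup.Build pi1
  pi1_mulA pi1_mul1 pi1_mulr1 pi1_mulV pi1_mulrV.

End FundamentalGroup.

Arguments pi1 R {T} x0.

(* A left action of the (discrete) group G on T by homeomorphisms. *)
Record top_action (G : groupType) (T : topologicalType) := TopAction {
  act :> G -> T -> T;
  act1 : forall x, act 1%g x = x;
  actM : forall g h x, act (g * h)%g x = act g (act h x);
  act_cts : forall g, continuous (act g) }.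

Arguments act_cts {G T} t g.

Section OrbifoldFundamentalGroup.
Context {R : realType} {G : groupType} {T : topologicalType}.
Context (a : top_action G T) (x0 : T).

(* The orbifold fundamental group of the global quotient [T/G] at x0: classes of
   pairs (g, p) where p is a path from x0 to g x0, up to homotopy of p relative
   to its endpoints, with (g, p) (h, q) = (g h, p followed by g q). When the
   action is free and properly discontinuous this is pi1 of T/G. *)
Record orbloop := OrbLoop {
  orb_elt : G;
  orb_fun : R -> T;
  orbloopP : is_path orb_fun x0 (a orb_elt x0) }.

HB.instance Definition _ := gen_eqMixin orbloop.
HB.instance Definition _ := gen_choiceMixin orbloop.

Definition orbhomotopic (f g : orbloop) :=
  orb_elt f = orb_elt g /\ homotopic (orb_fun f) (orb_fun g).

Definition orbloop_rel : rel orbloop := fun f g => `[< orbhomotopic f g >].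

Lemma orbloop_rel_equiv : equiv_class_of orbloop_rel.
Proof.
split=> [f|f g|g f h].
- by apply/asboolP; split=> //; apply: homotopic_refl; have [] := orbloopP f.
- by apply/asboolP/asboolP => -[e fg]; split; rewrite ?e//; exact: homotopic_sym.
- move=> /asboolP[e fg] /asboolP[e' gh]; apply/asboolP; split.
    by rewrite e.
  exact: homotopic_trans fg gh.
Qed.

Canonical orbloop_equiv := EquivRelPack orbloop_rel_equiv.

Definition orbpi1 := {eq_quot orbloop_equiv}.

HB.instance Definition _ := Choice.on orbpi1.
HB.instance Definition _ := EqQuotient.on orbpi1.

Lemma orbloop1_proof : is_path (fun _ : R => x0) x0 (a 1%g x0).
Proof. by rewrite act1; exact: is_path_cst. Qed.

Lemma orbloopM_proof (f g : orbloop) :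
  is_path (path_cat (orb_fun f) (a (orb_elt f) \o orb_fun g)) x0
    (a (orb_elt f * orb_elt g)%g x0).
Proof.
rewrite actM; apply: is_path_cat (orbloopP f) _.
exact: (is_path_map (act_cts a _) (orbloopP g)).
Qed.

Lemma orbloopV_proof (f : orbloop) :
  is_path (a (orb_elt f)^-1%g \o path_rev (orb_fun f)) x0
    (a (orb_elt f)^-1%g x0).
Proof.
have := is_path_map (act_cts a (orb_elt f)^-1%g) (is_path_rev (orbloopP f)).
by rewrite -actM mulVg act1.
Qed.

Definition orbloop1 := OrbLoop orbloop1_proof.
Definition orbloopM (f g : orbloop) := OrbLoop (orbloopM_proof f g).
Definition orbloopV (f : orbloop) := OrbLoop (orbloopV_proof f).

Definition orbpi1_one : orbpi1 := \pi_orbpi1 orbloop1.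
Definition orbpi1_mul (u v : orbpi1) : orbpi1 :=
  \pi_orbpi1 (orbloopM (repr u) (repr v)).
Definition orbpi1_inv (u : orbpi1) : orbpi1 := \pi_orbpi1 (orbloopV (repr u)).

Lemma orbpi1_eqP (f g : orbloop) :
  (\pi_orbpi1 f = \pi_orbpi1 g) <-> orbhomotopic f g.
Proof. by split=> [/eqmodP/asboolP//|fg]; apply/eqmodP/asboolP. Qed.

Lemma orbpi1_reprP (f : orbloop) : orbhomotopic (repr (\pi_orbpi1 f)) f.
Proof. by apply/orbpi1_eqP; rewrite reprK. Qed.

Lemma orbpi1_mulE (f g : orbloop) :
  orbpi1_mul (\pi_orbpi1 f) (\pi_orbpi1 g) = \pi_orbpi1 (orbloopM f g).
Proof.
have [ef hf] := orbpi1_reprP f; have [eg hg] := orbpi1_reprP g.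
apply/orbpi1_eqP; split=> /=; rewrite ef ?eg//; apply: homotopic_cat => //.
- have [_ _ ->] := orbloopP (repr (\pi_orbpi1 f)).
  by rewrite /= ef; have [_ -> _] := orbloopP (repr (\pi_orbpi1 g)).
- exact: (homotopic_map (act_cts a _) hg).
Qed.

Lemma orbpi1_invE (f : orbloop) : orbpi1_inv (\pi_orbpi1 f) = \pi_orbpi1 (orbloopV f).
Proof.
have [ef hf] := orbpi1_reprP f.
apply/orbpi1_eqP; split=> /=; rewrite ef//.
by apply: (homotopic_map (act_cts a _)); exact: homotopic_rev.
Qed.

Lemma orbpi1_mulA : associative orbpi1_mul.
Proof.
elim/quotW=> f; elim/quotW=> g; elim/quotW=> h; rewrite (orbpi1_mulE g h) (orbpi1_mulE f g) !orbpi1_mulE.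
apply/orbpi1_eqP; split; first exact: mulgA.
apply: homotopic_sym => /=; rewrite path_cat_map.
have -> : a (orb_elt f * orb_elt g)%g \o orb_fun h =
    a (orb_elt f) \o (a (orb_elt g) \o orb_fun h).
  by apply/funext => t /=; rewrite actM.
apply: homotopic_catA (orbloopP f) _ _.
  exact: (is_path_map (act_cts a _) (orbloopP g)).
apply: (is_path_map (act_cts a _)).
exact: (is_path_map (act_cts a _) (orbloopP h)).
Qed.

Lemma orbpi1_mul1 : left_id orbpi1_one orbpi1_mul.
Proof.
elim/quotW=> f; rewrite /orbpi1_one orbpi1_mulE.
apply/orbpi1_eqP; split; first exact: mul1g.
rewrite /= (_ : a 1%g \o orb_fun f = orb_fun f); last first.
  by apply/funext => t /=; rewrite act1.
exact: homotopic_1cat (orbloopP f).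
Qed.

Lemma orbpi1_mulr1 : right_id orbpi1_one orbpi1_mul.
Proof.
elim/quotW=> f; rewrite /orbpi1_one orbpi1_mulE.
apply/orbpi1_eqP; split; first exact: mulg1.
exact: homotopic_cat1 (orbloopP f).
Qed.

Lemma orbpi1_mulV : left_inverse orbpi1_one orbpi1_inv orbpi1_mul.
Proof.
elim/quotW=> f; rewrite /orbpi1_one orbpi1_invE orbpi1_mulE.
apply/orbpi1_eqP; split; first exact: mulVg.
rewrite /= -path_cat_map.
have := homotopic_map (act_cts a (orb_elt f)^-1%g)
  (homotopic_Ncat (orbloopP f)).
rewrite (_ : a _ \o (fun=> a _ _) = fun=> x0)//.
by apply/funext => t /=; rewrite -actM mulVg act1.
Qed.

Lemma orbpi1_mulrV : right_inverse orbpi1_one orbpi1_inv orbpi1_mul.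
Proof.
elim/quotW=> f; rewrite /orbpi1_one orbpi1_invE orbpi1_mulE.
apply/orbpi1_eqP; split; first exact: mulgV.
rewrite /= compA (_ : a (orb_elt f) \o a (orb_elt f)^-1%g = idfun); last first.
  by apply/funext => t /=; rewrite -actM mulgV act1.
exact: homotopic_catN (orbloopP f).
Qed.

HB.instance Definition _ := isGroup.Build orbpi1
  orbpi1_mulA orbpi1_mul1 orbpi1_mulr1 orbpi1_mulV orbpi1_mulrV.

End OrbifoldFundamentalGroup.

Arguments orbpi1 R {G T} a x0.

Definition Cplx (R : realType) : numClosedFieldType := R[i].

Section CyclicWreathProduct.
Variables m n : nat.

(* Z_m^n x| S_n. Permutations compose left to right in MathComp,
   (s * t) i = t (s i), so precomposition by s is a left action of 'S_n. *)
Definition wreath : Type := ({ffun 'I_n -> 'Z_m} * 'S_n)%type.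

HB.instance Definition _ := Choice.on wreath.

Definition wreath_one : wreath := ([ffun=> 0], 1%g).
Definition wreath_mul (v w : wreath) : wreath :=
  ([ffun i => v.1 i + w.1 (v.2 i)], (v.2 * w.2)%g).
Definition wreath_inv (v : wreath) : wreath :=
  ([ffun i => - v.1 (v.2^-1%g i)], v.2^-1%g).

Lemma wreath_mulA : associative wreath_mul.
Proof.
move=> u v w; congr pair; rewrite /= ?mulgA//.
by apply/ffunP => i; rewrite !ffunE permM addrA.
Qed.

Lemma wreath_mul1 : left_id wreath_one wreath_mul.
Proof.
move=> [a s]; congr pair; rewrite /= ?mul1g//.
by apply/ffunP => i; rewrite !ffunE perm1 add0r.
Qed.

Lemma wreath_mulr1 : right_id wreath_one wreath_mul.
Proof.
move=> [a s]; congr pair; rewrite /= ?mulg1//.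
by apply/ffunP => i; rewrite !ffunE addr0.
Qed.

Lemma wreath_mulV : left_inverse wreath_one wreath_inv wreath_mul.
Proof.
move=> [a s]; congr pair; rewrite /= ?mulVg//.
by apply/ffunP => i; rewrite !ffunE addNr.
Qed.

Lemma wreath_mulrV : right_inverse wreath_one wreath_inv wreath_mul.
Proof.
move=> [a s]; congr pair; rewrite /= ?mulgV//.
by apply/ffunP => i; rewrite !ffunE permK addrN.
Qed.

HB.instance Definition _ := isGroup.Build wreath
  wreath_mulA wreath_mul1 wreath_mulr1 wreath_mulV wreath_mulrV.

End CyclicWreathProduct.

Section OrbifoldBraidGroup.
Context {R : realType}.
Variables m n : nat.
Local Notation C := (Cplx R).

Definition expi (x : R) : C := Complex (cos x) (sin x).

(* The rotation by 2 pi k / m; #|'Z_m| is m as soon as 1 < m. *)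
Definition rot (k : 'Z_m) : C := expi (2 * pi * k%:R / #|'Z_m|%:R).

Lemma expiD x y : expi (x + y) = expi x * expi y.
Proof.
rewrite /expi cosD sinD [RHS]/(GRing.mul _ _)/=.
by congr Complex; rewrite addrC [X in _ + X]mulrC//.
Qed.

Lemma expi2pi k : expi (2 * pi * k%:R) = 1.
Proof.
elim: k => [|k ih]; first by rewrite mulr0 /expi cos0 sin0.
rewrite -(natr1 k) mulrDr mulr1 expiD ih mul1r /expi mulrC mulr_natr.
by rewrite cos2pi sin2pi.
Qed.

Lemma rotD k l : rot (k + l) = rot k * rot l.
Proof.
rewrite /rot card_ord -expiD -mulrDl -mulrDr -natrD /=.
set N := (Zp_trunc m).+2; set j := (k + l)%N.
rewrite [in RHS](divn_eq j N) natrD [in RHS]mulrDr mulrDl expiD natrM mulrA.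
by rewrite mulfK ?expi2pi ?mul1r// pnatr_eq0.
Qed.

Lemma rot0 : rot 0 = 1.
Proof. by rewrite /rot mulr0 mul0r /expi cos0 sin0. Qed.

Lemma rotV k : rot (- k) * rot k = 1.
Proof. by rewrite -rotD addNr rot0. Qed.

Lemma norm_rot k : `|rot k| = 1.
Proof.
by rewrite /rot/expi (normc_def (Complex _ _)) /= cos2Dsin2 sqrtr1.
Qed.

(* D is the closed unit disk, on which Z_m acts by rotations about 0. *)
Definition diskConf : set 'cV[C]_n := [set x |
  (forall i, `|x i ord0| <= 1) /\
  (forall i j, i != j -> forall g : 'Z_m, x i ord0 <> rot g * x j ord0)].

Definition conf_move (w : wreath m n) (x : 'cV[C]_n) : 'cV[C]_n :=
  \col_i (rot (w.1 i) * x (w.2 i) ord0).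

Lemma conf_move_stable w (x : 'cV[C]_n) :
  diskConf x -> diskConf (conf_move w x).
Proof.
move=> [x1 xD]; split=> [i|i j ij g]; rewrite !mxE.
  by rewrite normrM norm_rot mul1r.
move=> /(congr1 (fun z => rot (- w.1 i) * z)).
rewrite !mulrA rotV mul1r -!rotD => /xD; apply.
by rewrite (inj_eq perm_inj).
Qed.

Definition conf_act (w : wreath m n) (x : diskConf) : diskConf :=
  exist _ (conf_move w (val x)) (mem_set (conf_move_stable w (set_valP x))).

Lemma conf_act1 x : conf_act 1%g x = x.
Proof.
apply: val_inj; apply/colP => i /=.
by rewrite mxE ffunE rot0 mul1r perm1.
Qed.

Lemma conf_actM v w x : conf_act (v * w)%g x = conf_act v (conf_act w x).
Proof.
apply: val_inj; apply/colP => i /=.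
by rewrite !mxE ffunE rotD mulrA permM.
Qed.

Lemma conf_move_cts w : continuous (conf_move w).
Proof.
move=> x A [P nP PA].
have ci i : continuous (fun y : 'cV[C]_n => conf_move w y i ord0).
  have -> : (fun y : 'cV[C]_n => conf_move w y i ord0) =
      (fun y : 'cV[C]_n => rot (w.1 i) * y (w.2 i) ord0).
    by apply/funext => y; rewrite mxE.
  move=> y; apply: (@continuous_comp _ C C (fun y : 'cV[C]_n => y (w.2 i) ord0)).
    exact: coord_continuous.
  exact: mulrl_continuous.
have : \forall y \near x, forall i : 'I_n, P i ord0 (conf_move w y i ord0).
  apply: (@filter_forall _ _ _ _ (nbhs_filter x)) => i.
  exact: (ci i x _ (nP i ord0)).
by apply: filterS => y yP; apply: PA => i j; rewrite ord1; exact: yP.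
Qed.

Lemma conf_act_cts w : continuous (conf_act w).
Proof.
apply: continuous_comp_initial => x.
apply: (@continuous_comp _ _ _ set_val (conf_move w)).
  exact: initial_continuous.
exact: conf_move_cts.
Qed.

Definition conf_action : top_action (wreath m n) diskConf :=
  TopAction conf_act1 conf_actM conf_act_cts.

(* Z_n(D_{Z_m}), based at x0. *)
Definition orbBraid (x0 : diskConf) := orbpi1 R conf_action x0.

End OrbifoldBraidGroup.

Section ComplexBraidGroup.
Context {R : realType}.
Variables m n : nat.
Local Notation C := (Cplx R).

(* G(m,m,n): s is the support of the monomial matrix w, whose non-zero entries
   are the w i (s i). *)
Definition Gmmn : set 'M[C]_n := [set w | exists s : 'S_n,
  [/\ forall i j, (w i j != 0) = (j == s i),
      forall i, w i (s i) ^+ m = 1 &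
      \prod_i w i (s i) = 1]].

(* kermx is a left kernel, so the kernel of r - 1 acting on column vectors is
   the one of the transpose; the last condition says that it is a hyperplane. *)
Definition Gmmn_reflection : set 'M[C]_n :=
  [set r | Gmmn r /\ (\rank (kermx (r - 1%:M)^T)).+1 = n].

Definition arrangement_compl : set 'cV[C]_n :=
  [set v | forall r, Gmmn_reflection r -> (r - 1%:M) *m v <> 0].

Definition orbit_rel : rel arrangement_compl :=
  fun x y => `[< exists2 w, Gmmn w & val y = w *m val x >].

Lemma monomial_mulE (w : 'M[C]_n) (s : 'S_n) p (v : 'M[C]_(n, p)) i j :
  (forall i j, (w i j != 0) = (j == s i)) ->
  (w *m v) i j = w i (s i) * v (s i) j.
Proof.
move=> ws; rewrite mxE (bigD1 (s i))//= big1 ?addr0// => k.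
by rewrite -ws negbK => /eqP ->; rewrite mul0r.
Qed.

Lemma Gmmn1 : Gmmn 1%:M.
Proof.
exists 1%g; split=> [i j|i|]; rewrite ?mxE ?perm1.
- by rewrite [j == i]eq_sym; case: (i == j); rewrite ?mulr1n ?mulr0n ?oner_eq0 ?eqxx.
- by rewrite eqxx expr1n.
- by rewrite big1// => i _; rewrite !mxE perm1 eqxx.
Qed.

Lemma GmmnM v w : Gmmn v -> Gmmn w -> Gmmn (v *m w).
Proof.
move=> [s [vs vm vp]] [t [wt wm wp]]; exists (s * t)%g.
have vw i : (v *m w) i ((s * t)%g i) = v i (s i) * w (s i) (t (s i)).
  by rewrite permM (monomial_mulE _ _ _ vs).
split=> [i j|i|].
- by rewrite (monomial_mulE _ _ _ vs) mulf_eq0 negb_or vs eqxx wt permM.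
- by rewrite vw exprMn vm wm mulr1.
- under eq_bigr do rewrite vw.
  rewrite big_split/= vp mul1r -[RHS]wp.
  by rewrite [RHS](reindex_inj (@perm_inj _ s)).
Qed.

Lemma GmmnV w : Gmmn w -> exists2 w', Gmmn w' & w' *m w = 1%:M.
Proof.
move=> [s [ws wm wp]].
have w0 i : w i (s i) != 0 by rewrite ws.
pose c j := (w (s^-1%g j) j)^-1.
have cE i : c (s i) = (w i (s i))^-1 by rewrite /c permK.
pose w' : 'M[C]_n := \matrix_(i, j) (c i *+ (j == s^-1%g i)).
have w's i j : (w' i j != 0) = (j == s^-1%g i).
  rewrite mxE; case: (j == _); last by rewrite mulr0n eqxx.
  by rewrite mulr1n invr_eq0 -{2}(permKV s i) w0.
have w'E i : w' i (s^-1%g i) = c i by rewrite mxE eqxx mulr1n.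
exists w'.
  exists s^-1%g; split=> // [i|].
    by rewrite w'E /c exprVn -{2}(permKV s i) wm invr1.
  under eq_bigr do rewrite w'E.
  rewrite (reindex_inj (@perm_inj _ s))/=.
  by under eq_bigr do rewrite cE; rewrite prodfV wp invr1.
apply/matrixP => i j; rewrite (monomial_mulE _ _ _ w's) w'E mxE.
have [<-|ij] := eqVneq i j; first by rewrite mulVf// -{2}(permKV s i) w0.
have /negbFE/eqP -> : (w (s^-1%g i) j != 0) = false.
  by rewrite ws permKV eq_sym (negbTE ij).
by rewrite mulr0.
Qed.

Lemma orbit_rel_equiv : equiv_class_of orbit_rel.
Proof.
have orbS x y : orbit_rel x y -> orbit_rel y x.
  move=> /asboolP[w Ww yE]; have [w' Ww' w'w] := GmmnV Ww.
  by apply/asboolP; exists w' => //; rewrite yE mulmxA w'w mul1mx.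
split=> [x|x y|y x z].
- by apply/asboolP; exists 1%:M; [exact: Gmmn1|rewrite mul1mx].
- by apply/idP/idP; exact: orbS.
- move=> /asboolP[w Ww yE] /asboolP[w' Ww' zE]; apply/asboolP.
  by exists (w' *m w); [exact: GmmnM|rewrite zE yE mulmxA].
Qed.

Canonical orbit_equiv := EquivRelPack orbit_rel_equiv.

Definition arrangement_quot := quotient_topology {eq_quot orbit_equiv}.

(* B(m,m,n), based at b0. *)
Definition cplxBraid (b0 : arrangement_quot) := pi1 R b0.

End ComplexBraidGroup.

Section Presentations.
Context {I : eqType}.

(* Words in the letters i (false) and i^-1 (true). *)
Definition word := seq (I * bool).

Definition wgen (i : I) : word := [:: (i, false)].
Definition winv (w : word) : word := rev [seq (p.1, ~~ p.2) | p <- w].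
Definition wcomm (v w : word) : word := v ++ w ++ winv v ++ winv w.
Fixpoint wexp (k : nat) (w : word) : word :=
  if k is k'.+1 then w ++ wexp k' w else [::].
(* The alternating word v w v ... with k factors. *)
Fixpoint walt (k : nat) (v w : word) : word :=
  if k is k'.+1 then v ++ walt k' w v else [::].

(* rels v w stands for the defining relation v = w; word_congr rels is equality
   in the group with generators I and these defining relations. *)
Inductive word_congr (rels : word -> word -> Prop) : word -> word -> Prop :=
| Congr_rel v w : rels v w -> word_congr rels v w
| Congr_cancel i b : word_congr rels [:: (i, b); (i, ~~ b)] [::]
| Congr_refl w : word_congr rels w w
| Congr_sym v w : word_congr rels v w -> word_congr rels w v
| Congr_trans v w z :
    word_congr rels v w -> word_congr rels w z -> word_congr rels v z
| Congr_cat v v' w w' :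
    word_congr rels v v' -> word_congr rels w w' ->
    word_congr rels (v ++ w) (v' ++ w').

Definition word_eval (G : groupType) (g : I -> G) (w : word) : G :=
  (\prod_(p <- w) (if p.2 then (g p.1)^-1 else g p.1))%g.

(* The family g induces an isomorphism from the group with generators I and
   defining relations rels onto G. *)
Definition has_presentation (G : groupType) (g : I -> G)
    (rels : word -> word -> Prop) : Prop :=
  (forall x, exists w, x = word_eval g w) /\
  (forall v w, word_eval g v = word_eval g w <-> word_congr rels v w).

End Presentations.

Arguments word I : clear implicits.

(* The relations of Z_n(D_{Z_m}): 0 is the generator u and j > 0 is h_j. *)
Inductive orbBraid_rel (m n : nat) : word 'I_n -> word 'I_n -> Prop :=
| OrbBraid_order (u : 'I_n) :
    u = 0%N :> nat -> orbBraid_rel m (wexp m (wgen u)) [::]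
| OrbBraid_braid (i j : 'I_n) :
    (0 < i)%N -> j = i.+1 :> nat ->
    orbBraid_rel m (wgen i ++ wgen j ++ wgen i) (wgen j ++ wgen i ++ wgen j)
| OrbBraid_comm (k l : 'I_n) :
    (0 < k)%N -> (0 < l)%N -> (k + 2 <= l)%N || (l + 2 <= k)%N ->
    orbBraid_rel m (wcomm (wgen k) (wgen l)) [::]
| OrbBraid_ucomm (u j : 'I_n) :
    u = 0%N :> nat -> (2 <= j)%N ->
    orbBraid_rel m (wcomm (wgen u) (wgen j)) [::]
| OrbBraid_hu (u h1 : 'I_n) :
    u = 0%N :> nat -> h1 = 1%N :> nat ->
    orbBraid_rel m (wcomm (wgen h1 ++ wgen u ++ wgen h1) (wgen u)) [::].

(* The relations of Atilde(Delta_n^m): 0 is the generator h_1^u, of subscript 1,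
   and j > 0 is h_j. *)
Definition subscript n (i : 'I_n) : nat := maxn 1 i.

Inductive Atilde_rel (m n : nat) : word 'I_n -> word 'I_n -> Prop :=
| Atilde_braid (x y : 'I_n) :
    (subscript y = (subscript x).+1) \/ (subscript x = (subscript y).+1) ->
    Atilde_rel m (wgen x ++ wgen y ++ wgen x) (wgen y ++ wgen x ++ wgen y)
| Atilde_comm (x y : 'I_n) :
    (subscript x + 2 <= subscript y)%N || (subscript y + 2 <= subscript x)%N ->
    Atilde_rel m (wcomm (wgen x) (wgen y)) [::]
| Atilde_alt (h1u h1 : 'I_n) :
    h1u = 0%N :> nat -> h1 = 1%N :> nat ->
    Atilde_rel m (walt m (wgen h1) (wgen h1u)) (walt m (wgen h1u) (wgen h1))
| Atilde_square (h1u h1 h2 : 'I_n) :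
    h1u = 0%N :> nat -> h1 = 1%N :> nat -> h2 = 2%N :> nat ->
    Atilde_rel m (wexp 2 (wgen h1 ++ wgen h1u ++ wgen h2))
                 (wexp 2 (wgen h2 ++ wgen h1 ++ wgen h1u)).

Arguments orbBraid_rel m n : clear implicits.
Arguments Atilde_rel m n : clear implicits.

Section GroupNotions.
Context {G : groupType}.
Local Open Scope group_scope.

Definition grp_center : set G := [set z | forall x, commute z x].

Definition is_subgroup (H : set G) : Prop :=
  H 1 /\ forall x y, H x -> H y -> H (x * y^-1).

Definition subgroup_gen (S : set G) : set G := smallest is_subgroup S.

(* Generators indexed as above: a at 0 and h j at j > 0; the values of h outside
   1, ..., n - 1 are irrelevant, here and in gamma and theta. *)
Definition generators n (a : G) (h : nat -> G) (i : 'I_n) : G :=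
  if i == 0%N :> nat then a else h i.

Definition gamma (u : G) (h : nat -> G) (j : nat) : G :=
  (\prod_(k <- rev (index_iota 1 j)) h k) * u * (\prod_(1 <= k < j) h k).

Definition theta (u : G) (h : nat -> G) (n : nat) : G :=
  \prod_(j <- rev (index_iota 1 n.+1)) gamma u h j.

End GroupNotions.

(* f is an isomorphism of G onto the subgroup S of H. *)
Definition identifies (G H : groupType) (f : G -> H) (S : set H) : Prop :=
  [/\ {morph f : x y / (x * y)%g}, injective f & range f = S].

(* Main.v *)
Require Import Defs.
From mathcomp Require Import all_boot all_order all_algebra all_fingroup.
From mathcomp Require Import all_classical all_reals all_analysis.
From mathcomp Require Import zify.

(** The argument uses only the presentation of Z_n(D_{Z_m}) and the injectivity of
    the identification: a preimage in B(m,m,n) of a central element is central,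
    so it suffices that theta_n is central, that theta_n^l lies in the subgroup
    identified with B(m,m,n), and that theta_n^l is not 1.

    The elements gamma_j satisfy gamma_1 = u and gamma_(j+1) = h_j gamma_j h_j.
    They behave like Jucys-Murphy elements (in the braid picture, gamma_j takes
    the j-th strand once around the cone point and around the strands
    before it): h_k commutes with gamma_j unless j is k or k + 1
    ([commute_h_gamma_small], [commute_h_gamma_large]), and the gamma_j commute
    with one another ([commute_gamma]). Hence u = gamma_1 commutes with their
    product theta_n, and so does each h_k, because it commutes with
    gamma_(k+1) gamma_k = h_k gamma_k h_k gamma_k: this is the relation
    between gamma_(k+1) and gamma_k read differently.
    Thus theta_n is central in Z_n(D_{Z_m}) ([commute_theta]).

    Let N be the subgroup generated by the h_j and u h_1 u^-1. Conjugation by u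
    maps N into itself ([Nsub_conj]), so that the cosets N u^k multiply as
    their exponents add up. Every gamma_j is in N u, hence theta_n is in N u^n
    and theta_n^l in N u^(ln) = N, since m divides ln and u^m = 1.

    Finally, all the relations preserve the exponent sum of the letters h_j, and
    theta_n has exponent sum n (n - 1) ([has_degree_theta]), so that no positive
    power of theta_n is trivial. *)

Local Open Scope group_scope.

(** * Products defining gamma and theta *)

Section GammaTheta.
Context {G : groupType} (u : G) (h : nat -> G).

Lemma rev_index_iotaS a b : (a <= b)%N ->
  rev (index_iota a b.+1) = b :: rev (index_iota a b).
Proof.
by move=> ab; rewrite /index_iota subSn// -addn1 iotaD subnKC// cats1 rev_rcons.
Qed.

Lemma gamma1 : gamma u h 1 = u.
Proof. by rewrite /gamma /index_iota !big_nil mul1g mulg1. Qed.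

Lemma gammaS j : (0 < j)%N -> gamma u h j.+1 = h j * gamma u h j * h j.
Proof.
move=> j0; rewrite /gamma rev_index_iotaS// big_cons big_nat_recr//=.
by rewrite !mulgA.
Qed.

Lemma theta0 : theta u h 0 = 1.
Proof. by rewrite /theta /index_iota big_nil. Qed.

Lemma thetaS k : theta u h k.+1 = gamma u h k.+1 * theta u h k.
Proof. by rewrite /theta rev_index_iotaS// big_cons. Qed.

End GammaTheta.

(** * Centrality of theta *)

Section Central.
Context {G : groupType} (u : G) (h : nat -> G) (n : nat).
Hypothesis h_braid : forall j, (0 < j)%N -> (j.+1 < n)%N ->
  h j * h j.+1 * h j = h j.+1 * h j * h j.+1.
Hypothesis h_comm : forall k l, (0 < k)%N -> (k.+1 < l < n)%N ->
  commute (h k) (h l).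
Hypothesis uh_comm : forall j, (1 < j < n)%N -> commute u (h j).
Hypothesis huh_comm : commute (h 1%N * u * h 1%N) u.

Local Notation gam := (gamma u h).

Lemma commute_flank (x a g : G) :
  commute x a -> commute x g -> commute x (a * g * a).
Proof. by move=> xa xg; do 2?[apply: commuteM => //]. Qed.

(** Such a gamma_j is a word in u and h_1, ..., h_(k-2). *)
Lemma commute_h_gamma_small j k : (0 < j < k)%N -> (k < n)%N ->
  commute (h k) (gam j).
Proof.
elim: j => [//|[|j] IH] /andP[_ jk] kn.
  by rewrite gamma1; apply/commute_sym/uh_comm; lia.
have c : commute (h k) (h j.+1) by apply/commute_sym/h_comm; lia.
by rewrite gammaS//; apply: commute_flank => //; apply: IH; lia.
Qed.

Lemma commute_braid_conj (a b g : G) : a * b * a = b * a * b -> commute b g ->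
  commute a (b * (a * g * a) * b).
Proof.
rewrite /commute => ab bg.
have -> : a * (b * (a * g * a) * b) = a * b * a * g * a * b by rewrite !mulgA.
have -> : b * (a * g * a) * b * a = b * a * g * (a * b * a) by rewrite !mulgA.
by rewrite ab -!mulgA (mulgA b g) bg !mulgA.
Qed.

(** It suffices to treat gamma_(k+2) = h_(k+1) h_k gamma_k h_k h_(k+1), where the
    braid relation moves h_k from one end to the other as h_(k+1), which commutes
    with gamma_k; all further h_j commute with h_k. *)
Lemma commute_h_gamma_large j k : (0 < k)%N -> (k.+1 < j <= n)%N ->
  commute (h k) (gam j).
Proof.
move=> k0; elim: j => [//|j IH] /andP[kj jn].
have [jE|jk] := eqVneq j k.+1.
  rewrite jE 2?gammaS//; apply: commute_braid_conj; first by apply: h_braid; lia.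
  by apply: commute_h_gamma_small; lia.
have c : commute (h k) (h j) by apply: h_comm; lia.
rewrite gammaS; last by lia.
by apply: commute_flank => //; apply: IH; lia.
Qed.

Lemma commute_gamma_u j : (0 < j <= n)%N -> commute (gam j) u.
Proof.
elim: j => [//|[|[|j]] IH] /andP[_ jn].
- by rewrite gamma1.
- by rewrite gammaS// gamma1.
- apply: commute_sym; rewrite gammaS//.
  have c : commute u (h j.+2) by apply: uh_comm; lia.
  by apply: commute_flank => //; apply/commute_sym/IH; lia.
Qed.

(** For i < j, gamma_i is a word in u and the h_k with k + 1 < j. *)
Lemma commute_gamma i j : (0 < i < j)%N -> (j <= n)%N ->
  commute (gam j) (gam i).
Proof.
move=> + jn; elim: i => [//|[|i] IH] /andP[_ ij].
  by rewrite gamma1; apply: commute_gamma_u; lia.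
have c : commute (gam j) (h i.+1).
  by apply/commute_sym/commute_h_gamma_large; lia.
by rewrite gammaS//; apply: commute_flank => //; apply: IH; lia.
Qed.

Lemma commute_u_theta k : (k <= n)%N -> commute u (theta u h k).
Proof.
elim: k => [_|k IH kn]; first by rewrite theta0; apply: commute1.
rewrite thetaS; apply: commuteM; last by apply: IH; lia.
by apply/commute_sym/commute_gamma_u; lia.
Qed.

Lemma commute_h_theta_small j k : (j < k < n)%N -> commute (h k) (theta u h j).
Proof.
elim: j => [_|j IH jk]; first by rewrite theta0; apply: commute1.
rewrite thetaS; apply: commuteM; last by apply: IH; lia.
by apply: commute_h_gamma_small; lia.
Qed.

Lemma commute_h_gamma_pair k : (0 < k < n)%N ->
  commute (h k) (gam k.+1 * gam k).
Proof.
move=> /andP[k0 kn].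
have := commute_gamma k k.+1; rewrite k0 ltnSn kn => /(_ isT isT).
rewrite /commute gammaS//; move: (gam k) => g E.
by rewrite {1}E !mulgA.
Qed.

Lemma commute_h_theta k j : (0 < k < j)%N -> (j <= n)%N ->
  commute (h k) (theta u h j).
Proof.
elim: j => [|j IH] kj jn; first by rewrite ltn0 andbF in kj.
rewrite thetaS.
have [kE|kj'] := eqVneq k j; last first.
  by apply: commuteM; [apply: commute_h_gamma_large|apply: IH]; lia.
subst k; case: j {IH} kj jn => [//|j] _ jn; rewrite thetaS mulgA.
apply: commuteM; first by apply: commute_h_gamma_pair; lia.
by apply: commute_h_theta_small; lia.
Qed.

End Central.

(** * The subgroup generated by the h_j and a conjugate of h_1 *)

Section Generated.
Context {G : groupType} (S : set G).

Lemma subgroup_gen_sub x : S x -> subgroup_gen S x.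
Proof. exact: sub_gen_smallest. Qed.

Lemma subgroup_genP : is_subgroup (subgroup_gen S).
Proof.
split=> [A [[A1 _] _]//|x y Sx Sy A AS].
by have [[_ AM] _] := AS; apply: AM; [apply: Sx|apply: Sy].
Qed.

Lemma subgroup_gen1 : subgroup_gen S 1.
Proof. by case: subgroup_genP. Qed.

Lemma subgroup_genV x : subgroup_gen S x -> subgroup_gen S x^-1.
Proof.
by move=> Sx; rewrite -[x^-1]mul1g; apply: (proj2 subgroup_genP) => //; exact: subgroup_gen1.
Qed.

Lemma subgroup_genM x y :
  subgroup_gen S x -> subgroup_gen S y -> subgroup_gen S (x * y).
Proof.
move=> Sx Sy; rewrite -[y]invgK; apply: (proj2 subgroup_genP) => //.
exact: subgroup_genV.
Qed.

Lemma subgroup_gen_conj (c : G) :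
  (forall x, S x -> subgroup_gen S (c * x * c^-1)) ->
  forall x, subgroup_gen S x -> subgroup_gen S (c * x * c^-1).
Proof.
move=> Sc; apply: smallest_sub => //; split=> [|x y Sx Sy].
  by rewrite mulg1 mulgV; exact: subgroup_gen1.
have -> : c * (x * y^-1) * c^-1 = (c * x * c^-1) * (c * y * c^-1)^-1.
  by rewrite !invgM invgK !mulgA mulgVK.
by apply: (proj2 subgroup_genP).
Qed.

End Generated.

Section Cosets.
Context {G : groupType} (u : G) (h : nat -> G) (n : nat).
Hypothesis n_gt1 : (1 < n)%N.
Hypothesis uh_comm : forall j, (1 < j < n)%N -> commute u (h j).
Hypothesis huh_comm : commute (h 1%N * u * h 1%N) u.

Definition Nsub : set G :=
  subgroup_gen ([set h j | j in [set j | (1 <= j < n)%N]] `|`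
                [set (u * h 1%N * u^-1)%g])%classic.

Lemma Nsub_h j : (0 < j < n)%N -> Nsub (h j).
Proof. by move=> jn; apply: subgroup_gen_sub; left; exists j. Qed.

Lemma Nsub_hu : Nsub (u * h 1%N * u^-1).
Proof. by apply: subgroup_gen_sub; right. Qed.

(** With a = h_1 and b = u a u^-1, the relation [a u a, u] = 1 amounts to
    u b u^-1 = b^-1 a b; conjugation by u sends a to b and fixes the other h_j. *)
Lemma Nsub_conj x : Nsub x -> Nsub (u * x * u^-1).
Proof.
apply: subgroup_gen_conj => {x} _ [[j /= jn <-]|->]; last first.
  set b := u * h 1%N * u^-1.
  have -> : u * b * u^-1 = b^-1 * h 1%N * b.
    have E : h 1%N * u * h 1%N = u * (h 1%N * u * h 1%N) * u^-1.
      by rewrite -huh_comm mulgK.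
    have -> : b^-1 * h 1%N * b =
        u * (h 1%N)^-1 * u^-1 * (h 1%N * u * h 1%N) * u^-1.
      by rewrite /b !invgM invgK !mulgA.
    by rewrite E /b !mulgA mulgVK mulgVK.
  apply: subgroup_genM; last exact: Nsub_hu.
  apply: subgroup_genM.
    by apply: subgroup_genV; exact: Nsub_hu.
  by apply: Nsub_h; rewrite n_gt1.
have [->|j1] := eqVneq j 1%N; first exact: Nsub_hu.
have j1n : (1 < j < n)%N by lia.
by rewrite (uh_comm _ j1n) mulgK; exact: Nsub_h.
Qed.

Lemma Nsub_conjX k x : Nsub x -> Nsub (u ^+ k * x * u ^- k).
Proof.
move=> Nx; elim: k => [|k IH]; first by rewrite expg0 mul1g invg1 mulg1.
by rewrite expgS invgM; have := Nsub_conj _ IH; rewrite !mulgA.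
Qed.

Definition in_coset (k : nat) (x : G) : Prop := Nsub (x * u ^- k).

Lemma in_cosetM k l x y :
  in_coset k x -> in_coset l y -> in_coset (k + l) (x * y).
Proof.
rewrite /in_coset => Nx Ny.
have -> : x * y * u ^- (k + l) =
    x * u ^- k * (u ^+ k * (y * u ^- l) * u ^- k).
  by rewrite expgnDr invgM !mulgA mulgVK.
by apply: subgroup_genM => //; exact: Nsub_conjX.
Qed.

Lemma in_cosetX k x j : in_coset k x -> in_coset (j * k) (x ^+ j).
Proof.
move=> Nx; elim: j => [|j IH].
  by rewrite /in_coset !expg0 mulgV; exact: subgroup_gen1.
by rewrite expgS mulSn; exact: in_cosetM.
Qed.

Lemma in_coset_gamma j : (0 < j <= n)%N -> in_coset 1 (gamma u h j).
Proof.
elim: j => [//|[|j] IH] /andP[_ jn].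
  by rewrite gamma1 /in_coset expg1 mulgV; exact: subgroup_gen1.
have Nh : in_coset 0 (h j.+1).
  by rewrite /in_coset expg0 invg1 mulg1; exact: Nsub_h.
rewrite gammaS//; apply: (in_cosetM 1 0) => //; apply: (in_cosetM 0 1) => //.
by apply: IH; lia.
Qed.

Lemma in_coset_theta k : (k <= n)%N -> in_coset k (theta u h k).
Proof.
elim: k => [_|k IH kn].
  by rewrite theta0 /in_coset expg0 mulgV; exact: subgroup_gen1.
by rewrite thetaS; apply: (in_cosetM 1); [exact: in_coset_gamma|apply: IH; lia].
Qed.

End Cosets.

(** * Relations and exponent sums from the presentation *)

Section WordEval.
Context {I : eqType} {G : groupType} (g : I -> G).

Lemma word_eval_cat v w :
  word_eval g (v ++ w) = word_eval g v * word_eval g w.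
Proof. by rewrite /word_eval big_cat. Qed.

Lemma word_eval_gen i : word_eval g (wgen i) = g i.
Proof. by rewrite /word_eval big_seq1. Qed.

Lemma word_eval_inv w : word_eval g (winv w) = (word_eval g w)^-1.
Proof.
elim: w => [|[i b] w IH]; first by rewrite /word_eval !big_nil invg1.
rewrite -[(i, b) :: w]cat1s word_eval_cat invgM -IH.
rewrite /winv map_cat rev_cat word_eval_cat; congr (_ * _).
by rewrite /word_eval !big_seq1 /=; case: b; rewrite ?invgK.
Qed.

Lemma word_eval_exp k w : word_eval g (wexp k w) = word_eval g w ^+ k.
Proof.
elim: k => [|k IH]; first by rewrite /word_eval big_nil.
by rewrite /= word_eval_cat IH expgS.
Qed.

Lemma word_eval_comm v w : word_eval g (wcomm v w) = word_eval g [::] ->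
  commute (word_eval g v) (word_eval g w).
Proof.
rewrite /wcomm !word_eval_cat !word_eval_inv [word_eval g [::]]big_nil.
by rewrite mulgA => E; apply: divg1_eq; rewrite invgM.
Qed.

End WordEval.

Section Degree.
Context {n : nat}.
Local Open Scope ring_scope.

(** The exponent sum of the letters h_j; the letter 0 is u. *)
Definition hdeg (w : word 'I_n) : int :=
  \sum_(p <- w) (if p.1 == 0%N :> nat then 0 else if p.2 then -1 else 1).

Lemma hdeg_cat v w : hdeg (v ++ w) = hdeg v + hdeg w.
Proof. by rewrite /hdeg big_cat. Qed.

Lemma hdeg_gen (i : 'I_n) : hdeg (wgen i) = (0 < i)%N%:Z.
Proof. by rewrite /hdeg big_seq1 /= lt0n; case: eqP. Qed.

Lemma hdeg_inv w : hdeg (winv w) = - hdeg w.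
Proof.
rewrite /hdeg /winv big_rev big_map -GRing.sumrN; apply: eq_bigr => -[i b] _ /=.
by case: eqP => _; case: b => //=; lia.
Qed.

Lemma hdeg_comm v w : hdeg (wcomm v w) = 0.
Proof. by rewrite /wcomm !hdeg_cat !hdeg_inv; lia. Qed.

Lemma hdeg_exp_u m (u : 'I_n) : u = 0%N :> nat -> hdeg (wexp m (wgen u)) = 0.
Proof.
move=> u0; elim: m => [|m IH]; first by rewrite /hdeg big_nil.
by rewrite -[wexp _ _]/(wgen u ++ wexp m (wgen u)) hdeg_cat IH hdeg_gen u0.
Qed.

Lemma hdeg_congr m v w : word_congr (orbBraid_rel m n) v w -> hdeg v = hdeg w.
Proof.
have hdeg0 : hdeg [::] = 0 by rewrite /hdeg big_nil.
elim=> {v w} [v w []||//|||].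
- by move=> u u0; rewrite hdeg_exp_u.
- move=> i j i0 ji; rewrite !hdeg_cat !hdeg_gen; lia.
- by move=> k l *; rewrite hdeg_comm.
- by move=> u j *; rewrite hdeg_comm.
- by move=> u j *; rewrite hdeg_comm.
- move=> i b; rewrite hdeg0 /hdeg 2!big_cons big_nil /=.
  by case: eqP => _; case: b.
- by move=> v w _ ->.
- by move=> v w z _ -> _ ->.
- by move=> v v' w w' _ vv' _ ww'; rewrite !hdeg_cat vv' ww'.
Qed.

End Degree.

Section Presentation.
Context {G : groupType} (u : G) (h : nat -> G) (n m : nat).
Hypothesis n_gt1 : (1 < n)%N.
Hypothesis pres : has_presentation (@generators _ n u h) (orbBraid_rel m n).

Local Notation gen := (@generators _ n u h).
Let o0 : 'I_n := Ordinal (ltnW n_gt1).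

Lemma gen_u : gen o0 = u. Proof. by []. Qed.

Lemma gen_h j (jn : (j < n)%N) : (0 < j)%N -> gen (Ordinal jn) = h j.
Proof. by rewrite /generators /= lt0n => /negbTE ->. Qed.

Lemma eval_rel v w : orbBraid_rel m n v w -> word_eval gen v = word_eval gen w.
Proof. by move=> vw; apply/(proj2 pres)/Congr_rel. Qed.

Lemma pres_order : u ^+ m = 1.
Proof.
have := eval_rel _ _ (@OrbBraid_order m n o0 erefl).
by rewrite word_eval_exp word_eval_gen [word_eval _ [::]]big_nil.
Qed.

Lemma pres_braid j : (0 < j)%N -> (j.+1 < n)%N ->
  h j * h j.+1 * h j = h j.+1 * h j * h j.+1.
Proof.
move=> j0 jn; have jn' := ltnW jn.
have := eval_rel _ _ (@OrbBraid_braid m n (Ordinal jn') (Ordinal jn) j0 erefl).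
by rewrite !word_eval_cat !word_eval_gen !gen_h// !mulgA.
Qed.

Lemma pres_comm k l : (0 < k)%N -> (k.+1 < l < n)%N -> commute (h k) (h l).
Proof.
move=> k0 /andP[kl ln]; have kn : (k < n)%N by lia.
have l0 : (0 < l)%N by lia.
have kl2 : (k + 2 <= l)%N || (l + 2 <= k)%N by lia.
have := eval_rel _ _ (@OrbBraid_comm m n (Ordinal kn) (Ordinal ln) k0 l0 kl2).
by move/word_eval_comm; rewrite !word_eval_gen !gen_h.
Qed.

Lemma pres_ucomm j : (1 < j < n)%N -> commute u (h j).
Proof.
move=> /andP[j1 jn].
have := eval_rel _ _ (@OrbBraid_ucomm m n o0 (Ordinal jn) erefl j1).
by move/word_eval_comm; rewrite !word_eval_gen gen_h//; lia.
Qed.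

Lemma pres_huh : commute (h 1%N * u * h 1%N) u.
Proof.
have := eval_rel _ _ (@OrbBraid_hu m n o0 (Ordinal n_gt1) erefl erefl).
by move/word_eval_comm; rewrite !word_eval_cat !word_eval_gen gen_h// mulgA.
Qed.

Lemma commute_theta x : commute (theta u h n) x.
Proof.
have [w ->] := proj1 pres x; rewrite /word_eval; apply: commute_prod => -[i b] _.
suff c : commute (theta u h n) (gen i) by case: b => //; exact: commuteV.
apply: commute_sym; rewrite /generators; case: eqP => [_|/eqP i0].
  exact: (commute_u_theta u h n pres_ucomm pres_huh).
apply: (commute_h_theta u h n pres_braid pres_comm pres_ucomm pres_huh) => //.
by rewrite lt0n i0 ltn_ord.
Qed.

Lemma Nsub_thetaX l : (m %| l * n)%N -> Nsub u h n (theta u h n ^+ l).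
Proof.
move=> /dvdnP[q ln].
have Nt := in_coset_theta u h n n_gt1 pres_ucomm pres_huh n (leqnn n).
have := in_cosetX u h n n_gt1 pres_ucomm pres_huh n _ l Nt.
by rewrite /in_coset ln mulnC expgnA pres_order expg1n invg1 mulg1.
Qed.

(** Stated with a witnessing word, which avoids constructing the exponent sum as
    a homomorphism on the group. *)
Definition has_degree (d : nat) (x : G) : Prop :=
  exists2 w, x = word_eval gen w & hdeg w = d.

Lemma has_degreeM d e x y :
  has_degree d x -> has_degree e y -> has_degree (d + e) (x * y).
Proof.
move=> [v -> vd] [w -> we]; exists (v ++ w); first by rewrite word_eval_cat.
by rewrite hdeg_cat vd we.
Qed.

Lemma has_degree1 : has_degree 0 1.
Proof. by exists [::]; rewrite /word_eval /hdeg big_nil. Qed.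

Lemma has_degree_eq1 d : has_degree d 1 -> d = 0%N.
Proof.
move=> [w w1 wd]; have : word_eval gen w = word_eval gen [::].
  by rewrite -w1 /word_eval big_nil.
by move/(proj2 pres)/hdeg_congr; rewrite wd /hdeg big_nil => -[].
Qed.

Lemma has_degreeX d x k : has_degree d x -> has_degree (k * d) (x ^+ k).
Proof.
move=> dx; elim: k => [|k IH]; first exact: has_degree1.
by rewrite expgS mulSn; exact: has_degreeM.
Qed.

Lemma has_degree_gamma j : (j < n)%N -> has_degree (2 * j) (gamma u h j.+1).
Proof.
elim: j => [_|j IH jn].
  by exists (wgen o0); rewrite ?gamma1 ?word_eval_gen ?hdeg_gen.
have dh : has_degree 1 (h j.+1).
  by exists (wgen (Ordinal jn)); rewrite ?word_eval_gen ?gen_h ?hdeg_gen.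
rewrite gammaS// (_ : 2 * j.+1 = 1 + 2 * j + 1)%N; last by lia.
by do 2?[apply: has_degreeM => //]; apply: IH; lia.
Qed.

Lemma has_degree_theta k : (k <= n)%N -> has_degree (k * k.-1) (theta u h k).
Proof.
elim: k => [_|k IH kn]; first by rewrite theta0; exact: has_degree1.
rewrite thetaS (_ : k.+1 * k.+1.-1 = 2 * k + k * k.-1)%N; last first.
  by case: k {IH kn} => [|k] /=; nia.
by apply: has_degreeM; [exact: has_degree_gamma|apply: IH; lia].
Qed.

Lemma thetaX_neq1 l : (0 < l)%N -> theta u h n ^+ l <> 1.
Proof.
move=> l0 t1; have := has_degreeX _ _ l (has_degree_theta _ (leqnn n)).
by rewrite t1 => /has_degree_eq1/eqP; rewrite !muln_eq0; lia.
Qed.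

End Presentation.

(** * The center of the complex braid group *)

Local Close Scope group_scope.
Local Open Scope classical_set_scope.

Theorem corollary4p3 (R : realType) (n m l : nat)
  (n_ge2 : (2 <= n)%N) (m_ge2 : (2 <= m)%N)
  (l_gt0 : (0 < l)%N) (m_dvd_ln : (m %| l * n)%N)
  (l_min : forall k : nat, (0 < k)%N -> (m %| k * n)%N -> (l <= k)%N)
  (* Z_n(D_{Z_m}) and its standard generators u, h_1, ..., h_(n-1) *)
  (x0 : @diskConf R m n) (u : orbBraid x0) (h : nat -> orbBraid x0)
  (Zn_pres : has_presentation (@generators _ n u h) (orbBraid_rel m n))
  (* B(m,m,n) = Atilde(Delta_n^m), with generators s *)
  (b0 : @arrangement_quot R m n) (s : 'I_n -> cplxBraid b0)
  (B_pres : has_presentation s (Atilde_rel m n))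
  (* the identification with the subgroup <h_1, ..., h_(n-1), u h_1 u^-1> *)
  (iota : cplxBraid b0 -> orbBraid x0)
  (iota_ident : identifies iota
     (subgroup_gen ([set h j | j in [set j | (1 <= j < n)%N]] `|`
                 [set (u * h 1%N * u^-1)%g])))
  (iota_gens : forall i : 'I_n,
     iota (s i) = @generators _ n (u * h 1%N * u^-1)%g h i) :
  exists z : cplxBraid b0,
    [/\ iota z = (theta u h n ^+ l)%g, z \in @grp_center (cplxBraid b0)
      & z <> 1%g].
Proof.
have [iotaM iota_inj iota_im] := iota_ident.
have [z _ zE] : range iota (theta u h n ^+ l)%g.
  by rewrite iota_im; exact: (Nsub_thetaX _ _ _ _ n_ge2 Zn_pres _ m_dvd_ln).
exists z; split=> //.
  apply/mem_set => x; apply: iota_inj; rewrite !iotaM zE.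
  apply/commute_sym/commuteX/commute_sym.
  exact: (commute_theta _ _ _ _ n_ge2 Zn_pres).
move=> z1; apply: (thetaX_neq1 _ _ _ _ n_ge2 Zn_pres _ l_gt0).
rewrite -zE z1; have := iotaM 1%g 1%g; rewrite mulg1 => E.
by apply: (mulgI (iota 1%g)); rewrite -E mulg1.
Qed.
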